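(* If $(y,\mathbf u,y^+)\in\widetilde{\mathbb S}$, then $X(y^+)\in\mathcal F(X(y))$.
   Context: System. $\mathbb X\subset\mathbb R^{n_x}$, $\mathbb U\subset\mathbb R^{n_u}$, $\mathbb W\subset\mathbb R^{n_x}$, $\Theta\subset\mathbb R^{n_\theta}$ are nonempty, compact, convex sets containing the origin, and $\Theta=\operatorname{conv}\{\theta_1,\dots,\theta_{\mathsf p}\}$ is a polytope. Put $\mathcal Z=\mathbb X\times\mathbb U\times\Theta$. The map $f:\mathcal Z\to\mathbb R^{n_x}$ admits a difference-of-convex (DC) decomposition $f_i=g_i-h_i$, $i=1,\dots,n_x$, with $g_i,h_i:\mathcal Z\to\mathbb R$ finite-valued convex. Vector inequalities are componentwise. Directional bounds. Fix $\bar z\in\operatorname{ri}(\mathcal Z)$ (relative interior) and subgradients $s_{g_i}\in\partial g_i(\bar z)$, $s_{h_i}\in\partial h_i(\bar z)$; set $g_i^L(z)=g_i(\bar z)+s_{g_i}^\top(z-\bar z)$ and $h_i^L(z)=h_i(\bar z)+s_{h_i}^\top(z-\bar z)$. For $c\in\mathbb R^{n_x}$ and $z\in\mathcal Z$ let $$\widetilde f(z;\bar z,c)=\sum_{i:\,c_i\ge0}c_i\bigl(g_i(z)-h_i^L(z)\bigr)+\sum_{i:\,c_i<0}c_i\bigl(g_i^L(z)-h_i(z)\bigr).$$ Template. $F\in\mathbb R^{\mathsf f\times n_x}$ is a fixed matrix with rows $F_1,\dots,F_{\mathsf f}$ such that $Fx\le0$ implies $x=0$. For $y\in\mathbb R^{\mathsf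 f}$, $X(y)=\{x\in\mathbb R^{n_x}\mid Fx\le y\}$. A matrix $E$ and matrices $W_1,\dots,W_{\mathsf v}\in\mathbb R^{n_x\times\mathsf f}$ are given (so that $\langle F,E,\{W_j\}\rangle$ is a ''configuration triple'') such that $X(y)=\operatorname{conv}\{W_1y,\dots,W_{\mathsf v}y\}$ for all $y$ with $Ey\le0$. Define $\widetilde f_F(x,u,\theta)\in\mathbb R^{\mathsf f}$ as the vector with $l$-th entry $\widetilde f((x,u,\theta);\bar z,F_l^\top)$, and $d\in\mathbb R^{\mathsf f}$ by $d_l=\max_{w\in\mathbb W}F_lw$. Vertex inputs. For $\mathbf u=(u_1,\dots,u_{\mathsf v})\in\mathbb R^{n_u\mathsf v}$, $U_j\mathbf u=u_j\in\mathbb R^{n_u}$. Propagation set. $\widetilde{\mathbb S}\subseteq\mathbb R^{\mathsf f}\times\mathbb R^{n_u\mathsf v}\times\mathbb R^{\mathsf f}$ is the set of all $(y,\mathbf u,y^+)$ such that $Ey\le0$ and, for all $j\in\{1,\dots,\mathsf v\}$, $k\in\{1,\dots,\mathsf p\}$: $W_jy\in\mathbb X$, $U_j\mathbf u\in\mathbb U$, and $\widetilde f_F(W_jy,U_j\mathbf u,\theta_k)+d\le y^+$. Robust successors. For compact $X\subseteq\mathbb X$, $\mathcal F(X)$ is the collection of all $X^+\subseteq\mathbb R^{n_x}$ such that for every $x\in X$ there exists $u\in\mathbb U$ with $f(x,u,\theta)+w\in X^+$ for all $\theta\in\Theta$ and all $w\in\mathbb W$. *)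

(* Defs.v *)
(* Vectors of R^n are columns 'cV[R]_n. *)
From HB Require Import structures.
From mathcomp Require Export all_boot all_order all_algebra.
From mathcomp Require Export all_classical all_reals all_analysis.
Export Order.TTheory GRing.Theory Num.Theory.
Export numFieldNormedType.Exports.

#[export] Set Implicit Arguments.
#[export] Unset Strict Implicit.
#[export] Unset Printing Implicit Defensive.

Local Open Scope classical_set_scope.
Local Open Scope ring_scope.

Definition vle (R : realType) (m : nat) (a b : 'cV[R]_m) : Prop :=
  forall i, a i 0 <= b i 0.

Definition dot (R : realType) (m : nat) (a b : 'cV[R]_m) : R :=
  (a^T *m b) 0 0.

Definition is_max (R : realType) (A : set R) (m : R) : Prop :=
  A m /\ ubound A m.

Definition conv_hull (R : realType) (V : lmodType R) (A : set V) : set V :=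
  [set x | exists n (a : 'I_n -> R) (v : 'I_n -> V),
    [/\ forall i, A (v i), forall i, 0 <= a i,
        \sum_i a i = 1 & x = \sum_i a i *: v i]].

Definition aff_hull (R : realType) (V : lmodType R) (A : set V) : set V :=
  [set x | exists n (a : 'I_n -> R) (v : 'I_n -> V),
    [/\ forall i, A (v i), \sum_i a i = 1 & x = \sum_i a i *: v i]].

(* The interior of A in the topology induced on its affine hull. *)
Definition rel_interior (R : realType) (V : normedModType R) (A : set V) :
    set V :=
  [set x | aff_hull A x /\ \forall y \near x, aff_hull A y -> A y].

Definition convex_body0 (R : realType) (n : nat) (A : set 'cV[R]_n) : Prop :=
  [/\ A !=set0, compact A, convex_set A & A 0].

(* Subdifferential at zb of a function with domain D; the values of phi outside
   D are not used. *)
Definition subdifferential (R : realType) (n : nat) (D : set 'cV[R]_n)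
    (phi : 'cV[R]_n -> R) (zb : 'cV[R]_n) : set 'cV[R]_n :=
  [set s | forall z, D z -> phi zb + dot s (z - zb) <= phi z].

(* The point (x, u, theta), seen in R^(nx + nu + nt). *)
Definition stack (R : realType) (nx nu nt : nat)
    (x : 'cV[R]_nx) (u : 'cV[R]_nu) (t : 'cV[R]_nt) : 'cV[R]_(nx + nu + nt) :=
  col_mx (col_mx x u) t.

Definition stack_set (R : realType) (nx nu nt : nat)
    (X : set 'cV[R]_nx) (U : set 'cV[R]_nu) (Theta : set 'cV[R]_nt) :
    set 'cV[R]_(nx + nu + nt) :=
  [set z | exists x u t, [/\ X x, U u, Theta t & z = stack x u t]].

Definition linearization (R : realType) (n : nat) (phi : 'cV[R]_n -> R)
    (zb s z : 'cV[R]_n) : R :=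
  phi zb + dot s (z - zb).

Definition dir_bound (R : realType) (nx n : nat)
    (g h : 'I_nx -> 'cV[R]_n -> R) (zb : 'cV[R]_n)
    (sg sh : 'I_nx -> 'cV[R]_n) (c : 'cV[R]_nx) (z : 'cV[R]_n) : R :=
  \sum_(i | 0 <= c i 0) c i 0 * (g i z - linearization (h i) zb (sh i) z) +
  \sum_(i | c i 0 < 0) c i 0 * (linearization (g i) zb (sg i) z - h i z).

Definition dir_bound_mx (R : realType) (nf nx n : nat) (F : 'M[R]_(nf, nx))
    (g h : 'I_nx -> 'cV[R]_n -> R) (zb : 'cV[R]_n)
    (sg sh : 'I_nx -> 'cV[R]_n) (z : 'cV[R]_n) : 'cV[R]_nf :=
  \col_l dir_bound g h zb sg sh (row l F)^T z.

Definition template (R : realType) (nf nx : nat) (F : 'M[R]_(nf, nx))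
    (y : 'cV[R]_nf) : set 'cV[R]_nx :=
  [set x | vle (F *m x) y].

Definition config_triple (R : realType) (nf nx ne nv : nat)
    (F : 'M[R]_(nf, nx)) (E : 'M[R]_(ne, nf))
    (W : 'I_nv -> 'M[R]_(nx, nf)) : Prop :=
  forall y, vle (E *m y) 0 ->
    template F y = conv_hull (range (fun j => W j *m y)).

(* The stacked vertex inputs live in R^(nu + ... + nu) (nv summands), written
   as a sum so that the j-th block is given by submxcol. *)
Definition vertex_input (R : realType) (nu nv : nat)
    (uu : 'cV[R]_(\sum_(j < nv) nu)) (j : 'I_nv) : 'cV[R]_nu :=
  @submxcol R nv (fun=> nu) 1 uu j.

Definition propagation_set (R : realType) (nx nu nt nf ne nv np : nat)
    (X : set 'cV[R]_nx) (U : set 'cV[R]_nu) (theta : 'I_np -> 'cV[R]_nt)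
    (F : 'M[R]_(nf, nx)) (E : 'M[R]_(ne, nf)) (W : 'I_nv -> 'M[R]_(nx, nf))
    (fF : 'cV[R]_(nx + nu + nt) -> 'cV[R]_nf) (d : 'cV[R]_nf) :
    set ('cV[R]_nf * 'cV[R]_(\sum_(j < nv) nu) * 'cV[R]_nf) :=
  [set p | let: (y, uu, yplus) := p in
    vle (E *m y) 0 /\
    forall j k,
      [/\ X (W j *m y), U (vertex_input uu j) &
          vle (fF (stack (W j *m y) (vertex_input uu j) (theta k)) + d) yplus]].

(* The collection is only meaningful for a compact Xs included in X; it is taken
   to be empty for any other Xs, so that membership includes definedness. *)
Definition robust_successors (R : realType) (nx nu nt : nat)
    (X : set 'cV[R]_nx) (U : set 'cV[R]_nu) (Theta : set 'cV[R]_nt)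
    (W : set 'cV[R]_nx) (f : 'cV[R]_(nx + nu + nt) -> 'cV[R]_nx)
    (Xs : set 'cV[R]_nx) : set (set 'cV[R]_nx) :=
  [set Xplus | [/\ compact Xs, Xs `<=` X &
    forall x, Xs x -> exists2 u, U u &
      forall t w, Theta t -> W w -> Xplus (f (stack x u t) + w)]].

(* Main.v *)
(* Write a state x in X(y) as a convex combination of the vertices W_j y and
   apply the same combination of the vertex inputs u_j. For each row F_l, the
   directional bound is convex in (x, u, theta) and dominates F_l f by the
   subgradient inequalities, so its value at (x, u, theta) is at most its
   largest value over the vertices (W_j y, u_j, theta_k), which is at most
   y+_l - d_l; the term d_l absorbs the disturbance. *)
Require Import Defs.
From mathcomp Require Import ring.

Local Open Scope classical_set_scope.
Local Open Scope ring_scope.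

Lemma convex_setP (R : realType) (V : lmodType R) (A : set V) :
  convex_set A <->
  forall x y (t : R), 0 <= t -> t <= 1 -> A x -> A y ->
    A (t *: x + (1 - t) *: y).
Proof.
split=> [cA x y t t0 t1 Ax Ay|cA x y t].
  by have := cA x y (Itv01 t0 t1); rewrite !inE; exact.
by rewrite !inE => Ax Ay; exact: (cA x y t%:num).
Qed.

(** Induction on the number of points: the first one is split off and the others are renormalized by
    their total weight [s]. If [s = 0], all the other weights vanish and only the first point
    remains. *)
Lemma convex_set_sum (R : realType) (V : lmodType R) (A : set V) (n : nat)
    (a : 'I_n -> R) (v : 'I_n -> V) :
  convex_set A -> (forall i, A (v i)) -> (forall i, 0 <= a i) ->
  \sum_i a i = 1 -> A (\sum_i a i *: v i).
Proof.
move=> /convex_setP cA; elim: n a v => [|n IH] a v Av a0.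
  by rewrite big_ord0 => /esym/eqP; rewrite oner_eq0.
rewrite !big_ord_recl => a1.
set s := \sum_(i < n) a (lift ord0 i) in a1.
have s0 : 0 <= s by exact: sumr_ge0.
have sE : s = 1 - a ord0 by rewrite -a1 addrAC subrr add0r.
have [s00|sN0] := eqVneq s 0.
  rewrite big1 ?addr0 => [|i _].
    by move: a1; rewrite s00 addr0 => ->; rewrite scale1r.
  have /eqP := s00; rewrite psumr_eq0// => /allP/(_ i).
  by rewrite mem_index_enum => /(_ isT)/eqP ->; rewrite scale0r.
have -> : \sum_(i < n) a (lift ord0 i) *: v (lift ord0 i) =
    s *: \sum_(i < n) (a (lift ord0 i) / s) *: v (lift ord0 i).
  rewrite scaler_sumr; apply: eq_bigr => i _.
  by rewrite scalerA mulrCA divff// mulr1.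
rewrite sE; apply: cA => //; first by rewrite -subr_ge0 -sE.
rewrite -sE; apply: IH => //.
- by move=> i; rewrite divr_ge0.
- by rewrite -mulr_suml divff.
Qed.

Lemma stack_comb (R : realType) (nx nu nt n : nat) (a : 'I_n -> R)
    (x : 'I_n -> 'cV[R]_nx) (u : 'I_n -> 'cV[R]_nu) (t : 'I_n -> 'cV[R]_nt) :
  stack (\sum_i a i *: x i) (\sum_i a i *: u i) (\sum_i a i *: t i) =
  \sum_i a i *: stack (x i) (u i) (t i).
Proof.
elim: n a x u t => [|n IH] a x u t; first by rewrite !big_ord0 /stack !col_mx0.
by rewrite !big_ord_recl -IH /stack !scale_col_mx !add_col_mx.
Qed.

Lemma convex_stack_set (R : realType) (nx nu nt : nat) (X : set 'cV[R]_nx)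
    (U : set 'cV[R]_nu) (T : set 'cV[R]_nt) :
  convex_set X -> convex_set U -> convex_set T -> convex_set (stack_set X U T).
Proof.
move=> /convex_setP cX /convex_setP cU /convex_setP cT; apply/convex_setP.
move=> _ _ t t0 t1 [x [u [p [Xx Uu Tp ->]]]] [x' [u' [p' [Xx' Uu' Tp' ->]]]].
exists (t *: x + (1 - t) *: x'), (t *: u + (1 - t) *: u').
exists (t *: p + (1 - t) *: p'); split; [exact: cX|exact: cU|exact: cT|].
by rewrite /stack !scale_col_mx !add_col_mx.
Qed.

Lemma linearization_comb (R : realType) (n : nat) (phi : 'cV[R]_n -> R)
    (zb s x y : 'cV[R]_n) (t : R) :
  linearization phi zb s (t *: x + (1 - t) *: y) =
  t * linearization phi zb s x + (1 - t) * linearization phi zb s y.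
Proof.
rewrite /linearization /dot !mulmxBr mulmxDr -!scalemxAr !mxE.
by ring.
Qed.

Lemma convex_functionW (R : realType) (V : lmodType R) (D : set V)
    (phi : V -> R) (x y : V) (t : R) :
  convex_function D phi -> 0 <= t -> t <= 1 -> D x -> D y ->
  phi (t *: x + (1 - t) *: y) <= t * phi x + (1 - t) * phi y.
Proof.
by move=> cphi t0 t1 Dx Dy; apply: (cphi (Itv01 t0 t1)); rewrite inE.
Qed.

Section dir_bound.
Context (R : realType) (nx n : nat) (D : set 'cV[R]_n)
  (g h : 'I_nx -> 'cV[R]_n -> R) (zb : 'cV[R]_n) (sg sh : 'I_nx -> 'cV[R]_n).

(** The sign of [c i 0] decides which of [g i], [h i] is linearized: a nonnegative coefficient
    multiplies a convex function, a negative one a concave function. Every term is thus convex. *)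
Lemma dir_bound_convex (c : 'cV[R]_nx) (x y : 'cV[R]_n) (t : R) :
  (forall i, convex_function D (g i)) -> (forall i, convex_function D (h i)) ->
  0 <= t -> t <= 1 -> D x -> D y ->
  dir_bound g h zb sg sh c (t *: x + (1 - t) *: y) <=
  t * dir_bound g h zb sg sh c x + (1 - t) * dir_bound g h zb sg sh c y.
Proof.
move=> cg ch t0 t1 Dx Dy; rewrite /dir_bound !mulrDr !mulr_sumr addrACA.
rewrite -!big_split/=; apply: lerD; apply: ler_sum => i ci;
  rewrite linearization_comb.
- rewrite [leRHS](_ : _ = c i 0 * ((t * g i x + (1 - t) * g i y) -
    (t * linearization (h i) zb (sh i) x +
     (1 - t) * linearization (h i) zb (sh i) y))); last by ring.
  by apply: ler_wpM2l => //; rewrite lerD2r; exact: convex_functionW.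
- rewrite [leRHS](_ : _ = c i 0 * ((t * linearization (g i) zb (sg i) x +
     (1 - t) * linearization (g i) zb (sg i) y) -
     (t * h i x + (1 - t) * h i y))); last by ring.
  apply: ler_wnM2l; first exact: ltW.
  by rewrite lerD2l lerN2; exact: convex_functionW.
Qed.

(** Keeping [D z] inside the set lets a single convex combination argument give both membership in
    the domain and the bound. *)
Lemma convex_dir_bound_sublevel (c : 'cV[R]_nx) (b : R) :
  convex_set D ->
  (forall i, convex_function D (g i)) -> (forall i, convex_function D (h i)) ->
  convex_set [set z | D z /\ dir_bound g h zb sg sh c z <= b].
Proof.
move=> /convex_setP cD cg ch; apply/convex_setP => x y t t0 t1 [Dx bx] [Dy by_].
split; first exact: cD.
apply: le_trans (dir_bound_convex c cg ch t0 t1 Dx Dy) _.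
rewrite [leRHS](_ : _ = t * b + (1 - t) * b); last by ring.
by rewrite lerD// ler_wpM2l// subr_ge0.
Qed.

(** Linearizations at [zb] minorize [g i] and [h i] on [D]. Replacing [h i] raises terms with
    nonnegative coefficient, and replacing [g i] raises those with negative coefficient. *)
Lemma dir_bound_ge (c : 'cV[R]_nx) (z : 'cV[R]_n) :
  (forall i, subdifferential D (g i) zb (sg i)) ->
  (forall i, subdifferential D (h i) zb (sh i)) -> D z ->
  \sum_i c i 0 * (g i z - h i z) <= dir_bound g h zb sg sh c z.
Proof.
move=> hsg hsh Dz; rewrite (bigID (fun i => 0 <= c i 0))/= /dir_bound.
apply: lerD.
  apply: ler_sum => i ci; apply: ler_wpM2l => //.
  by rewrite lerD2l lerN2; exact: hsh.
under eq_bigl do rewrite -ltNge.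
apply: ler_sum => i ci; apply: ler_wnM2l; first exact: ltW.
by rewrite lerD2r; exact: hsg.
Qed.

End dir_bound.

(** An intersection of closed half-spaces, one per row of [F]. Closedness gives compactness of X(y)
    once it lies in the compact state set. *)
Lemma closed_template (R : realType) (nf nx : nat) (F : 'M[R]_(nf, nx))
  (y : 'cV[R]_nf) : closed (template F y).
Proof.
have -> : template F y =
    \bigcap_(i in setT) ((fun x => (F *m x) i 0) @^-1` [set r | r <= y i 0]).
  by apply/seteqP; split=> [x xy i _|x xy i]; [exact: xy|exact: (xy i)].
apply: closed_bigI => i _; apply: preimage_closed; last exact: closed_le.
suff cF : continuous (fun x : 'cV[R]_nx => (F *m x) i 0).
  by move=> x _; exact: cF.
have -> : (fun x => (F *m x) i 0) = fun x : 'cV[R]_nx => \sum_j F i j * x j 0.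
  by apply/funext => x; rewrite mxE.
apply: continuous_big => [|j _ x]; first exact: add_continuous.
exact: (continuous_comp (@coord_continuous R nx 1 j 0 x)
  (@mulrl_continuous R _ _)).
Qed.

Theorem lemma8 (R : realType) (nx nu nt nf ne nv np : nat)
  (XX : set 'cV[R]_nx) (UU : set 'cV[R]_nu) (WW : set 'cV[R]_nx)
  (Theta : set 'cV[R]_nt) (theta : 'I_np -> 'cV[R]_nt)
  (hX : convex_body0 XX) (hU : convex_body0 UU)
  (hW : convex_body0 WW) (hTheta : convex_body0 Theta)
  (hpoly : Theta = conv_hull (range theta))
  (f : 'cV[R]_(nx + nu + nt) -> 'cV[R]_nx)
  (g h : 'I_nx -> 'cV[R]_(nx + nu + nt) -> R)
  (hg : forall i, convex_function (stack_set XX UU Theta) (g i))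
  (hh : forall i, convex_function (stack_set XX UU Theta) (h i))
  (hf : forall z, stack_set XX UU Theta z ->
          forall i, f z i 0 = g i z - h i z)
  (zb : 'cV[R]_(nx + nu + nt))
  (hzb : rel_interior (stack_set XX UU Theta) zb)
  (sg sh : 'I_nx -> 'cV[R]_(nx + nu + nt))
  (hsg : forall i, subdifferential (stack_set XX UU Theta) (g i) zb (sg i))
  (hsh : forall i, subdifferential (stack_set XX UU Theta) (h i) zb (sh i))
  (F : 'M[R]_(nf, nx)) (hF : forall x : 'cV[R]_nx, vle (F *m x) 0 -> x = 0)
  (E : 'M[R]_(ne, nf)) (W : 'I_nv -> 'M[R]_(nx, nf))
  (hFEW : config_triple F E W)
  (d : 'cV[R]_nf)
  (hd : forall l, is_max [set (row l F *m w) 0 0 | w in WW] (d l 0))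
  (y : 'cV[R]_nf) (uu : 'cV[R]_(\sum_(j < nv) nu)) (yplus : 'cV[R]_nf) :
  propagation_set XX UU theta F E W (dir_bound_mx F g h zb sg sh) d
    (y, uu, yplus) ->
  robust_successors XX UU Theta WW f (template F y) (template F yplus).
Proof.
move=> [Ey yuS]; case: hX hU hTheta => [_ kX cX _] [_ _ cU _] [_ _ cT T0].
(* The vertex constraints are quantified jointly over [j] and [k], so using those on [W j *m y] and
   the inputs requires some [k]. One exists because [Theta] contains 0 and an empty combination has
   total weight 0, not 1. *)
have [k0 _] : exists k : 'I_np, True.
  move: T0; rewrite hpoly => -[[|m] [b [s [sr _ b1 _]]]].
    by move/eqP: b1; rewrite big_ord0 eq_sym oner_eq0.
  by have [k _ _] := sr ord0; exists k.
have FX : template F y `<=` XX.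
  rewrite hFEW// => _ [n [a [v [vr a0 a1 ->]]]].
  apply: convex_set_sum => // i; have [j _ <-] := vr i.
  by have [] := yuS j k0.
split=> //.
  by apply: (subclosed_compact _ kX) FX; exact: closed_template.
move=> x; rewrite hFEW// => -[n [a [v [vr a0 a1 ->]]]].
(* The combination may repeat or omit vertices, so each of its points is assigned a vertex index,
   which also selects its input. *)
have {vr} /choice[j vE] : forall i, exists j, W j *m y = v i.
  by move=> i; have [j _ <-] := vr i; exists j.
exists (\sum_i a i *: vertex_input uu (j i)).
  by apply: convex_set_sum => // i; have [] := yuS (j i) k0.
move=> t w Tt Ww l; move: (Tt).
rewrite {1}hpoly => -[m [b [s [sr b0 b1 tE]]]].
pose Z := stack_set XX UU Theta.
have cZ : convex_set Z by exact: convex_stack_set.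
pose B := dir_bound g h zb sg sh (row l F)^T.
set z := stack _ _ _.
have [Zz Bz] : [set z | Z z /\ B z <= yplus l 0 - d l 0] z.
  (* The vertices are reached in two stages: first over states and inputs with [t] fixed, then over
     the parameter. The fixed blocks are constant combinations, as the weights sum to 1. *)
  have -> : z = \sum_i a i *: stack (v i) (vertex_input uu (j i)) t.
    by rewrite -stack_comb -scaler_suml a1 scale1r.
  apply: convex_set_sum => // [|i]; first exact: convex_dir_bound_sublevel.
  have -> : stack (v i) (vertex_input uu (j i)) t =
      \sum_r b r *: stack (v i) (vertex_input uu (j i)) (s r).
    by rewrite -stack_comb -!scaler_suml b1 !scale1r -tE.
  apply: convex_set_sum => // [|r]; first exact: convex_dir_bound_sublevel.
  have [k _ <-] := sr r; have [Xv Uu /(_ l)] := yuS (j i) k.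
  rewrite !mxE -lerBrDr -vE => Bk; split=> //.
  exists (W (j i) *m y), (vertex_input uu (j i)), (theta k); split=> //.
  (* A vertex of [Theta] is a combination of one point with weight 1. *)
  rewrite hpoly; exists 1%N, (fun=> 1), (fun=> theta k).
  by rewrite !big_ord1 scale1r; split=> // _; exists k.
have Fw : (F *m w) l 0 <= d l 0.
  by have [_] := hd l; apply; exists w => //; rewrite !mxE;
    apply: eq_bigr => i _; rewrite mxE.
(* Writing the bound as [(yplus l 0 - d l 0) + d l 0] separates the nominal part from the
   disturbance. *)
rewrite mulmxDr mxE -[leRHS](subrK (d l 0)) lerD//.
apply: le_trans Bz; apply: le_trans (dir_bound_ge _ hsg hsh Zz).
by rewrite mxE ler_sum// => i _; rewrite -hf// !mxE.
Qed.
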